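(* $(\mathfrak h_3\oplus\mathbb R,S_0^1,J)$ is a first kind algebraic Ricci soliton with respect to $\nabla^0$ with $c=0$ and $D=\operatorname{Ric}^0$; that is, $\operatorname{Ric}^0$ is a derivation of $\mathfrak h_3\oplus\mathbb R$.
   Context: $\mathfrak h_3\oplus\mathbb R$ is the real Lie algebra with basis $e_1,e_2,e_3,e_4$ and only non-zero bracket (up to skew-symmetry) $[e_1,e_2]=e_3$. $S_0^1$ is the Lorentzian inner product $\langle\cdot,\cdot\rangle$ whose matrix in $(e_1,e_2,e_3,e_4)$ is $\begin{bmatrix}1&0&0&0\\0&1&0&0\\0&0&0&1\\0&0&1&0\end{bmatrix}$. Fix the basis $v_1=e_1$, $v_2=e_2$, $v_3=\frac1{\sqrt2}(e_3+e_4)$, $v_4=\frac1{\sqrt2}(e_3-e_4)$, which is orthonormal: $\langle v_i,v_j\rangle=0$ for $i\ne j$, $\langle v_i,v_i\rangle=1$ for $i=1,2,3$, $\langle v_4,v_4\rangle=-1$. The product structure $J$ is the linear map with $Jv_i=v_i$ for $i=1,2,3$ and $Jv_4=-v_4$. Write $\mathfrak g$ for the Lie algebra. The Levi-Civita connection is the bilinear map $\nabla:\mathfrak g\times\mathfrak g\to\mathfrak g$ with $2\langle\nabla_uv,w\rangle=\langle[u,v],w\rangle+\langle[w,u],v\rangle+\langle[w,v],u\rangle$ for all $u,v,w$. Put $(\nabla_uJ)v=\nabla_u(Jv)-J(\nabla_uv)$. The canonical connection is $\nabla^0_uv=\nabla_uv-\frac12(\nabla_uJ)Jv$. Its curvature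 is $R^0_{uv}w=\nabla^0_{[u,v]}w-\nabla^0_u\nabla^0_vw+\nabla^0_v\nabla^0_uw$, and its Ricci operator is $\operatorname{Ric}^0(u)=\sum_{k=1}^4\langle v_k,v_k\rangle R^0_{v_ku}v_k$. A derivation of $\mathfrak g$ is a linear map $D:\mathfrak g\to\mathfrak g$ with $[D(u),v]+[u,D(v)]=D[u,v]$ for all $u,v\in\mathfrak g$. First kind algebraic Ricci soliton with respect to $\nabla^0$ means $\operatorname{Ric}^0=c\operatorname{Id}+D$ for some $c\in\mathbb R$ and some derivation $D$. *)

(* Defs.v *)
From mathcomp Require Import all_boot all_order all_algebra.
From mathcomp Require Import ring.
From mathcomp Require Import reals.

Set Implicit Arguments.
Unset Strict Implicit.
Unset Printing Implicit Defensive.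

Import Order.TTheory GRing.Theory Num.Theory.
Local Open Scope ring_scope.

Section Connections.
Variables (R : realType) (g : lmodType R).
Variables (br : g -> g -> g) (form : g -> g -> R).

Definition bilinear_map (b : g -> g -> g) : Prop :=
  (forall u, linear (b u)) /\ (forall v, linear (b^~ v)).

Definition lie_bracket : Prop :=
  [/\ bilinear_map br, forall u, br u u = 0 &
      forall u v w, br u (br v w) + br v (br w u) + br w (br u v) = 0].

Definition levi_civita (nabla : g -> g -> g) : Prop :=
  bilinear_map nabla /\
  forall u v w, 2 * form (nabla u v) w =
    form (br u v) w + form (br w u) v + form (br w v) u.

(* (nabla_u J) v *)
Definition nablaJ (nabla : g -> g -> g) (J : g -> g) (u v : g) : g :=
  nabla u (J v) - J (nabla u v).

Definition canonical_connection (nabla : g -> g -> g) (J : g -> g) (u v : g) : g :=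
  nabla u v - 2^-1 *: nablaJ nabla J u (J v).

(* Sign convention: R_{uv} = nabla_[u,v] - [nabla_u, nabla_v]. *)
Definition curvature (nabla : g -> g -> g) (u v w : g) : g :=
  nabla (br u v) w - nabla u (nabla v w) + nabla v (nabla u w).

Definition ricci n (v : 'I_n -> g) (nabla : g -> g -> g) (u : g) : g :=
  \sum_(k < n) form (v k) (v k) *: curvature nabla (v k) u (v k).

Definition derivation (D : g -> g) : Prop :=
  linear D /\ forall u v, br (D u) v + br u (D v) = D (br u v).

Definition first_kind_soliton_with n (v : 'I_n -> g) (nabla : g -> g -> g)
    (c : R) (D : g -> g) : Prop :=
  derivation D /\ forall u, ricci v nabla u = c *: u + D u.

End Connections.

Section Heisenberg.
Variable R : realType.
Local Notation g := 'rV[R]_4.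

(* The basis e_1, ..., e_4 is indexed from 0: e_(i+1) is [ebasis i]; likewise for [vframe]. *)
Definition ebasis (i : 'I_4) : g := delta_mx 0 i.

Definition h3R_bracket (x y : g) : g := (x 0 0 * y 0 1 - x 0 1 * y 0 0) *: ebasis 2.

Definition S01 : 'M[R]_4 := \matrix_(i, j)
  nth 0 (nth [::] [:: [:: 1; 0; 0; 0];
                      [:: 0; 1; 0; 0];
                      [:: 0; 0; 0; 1];
                      [:: 0; 0; 1; 0]] i) j.

Definition S01_form (x y : g) : R := (x *m S01 *m y^T) 0 0.

Definition vframe (i : 'I_4) : g :=
  nth 0 [:: ebasis 0; ebasis 1; (Num.sqrt 2)^-1 *: (ebasis 2 + ebasis 3);
            (Num.sqrt 2)^-1 *: (ebasis 2 - ebasis 3)] i.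

Definition product_structure (J : g -> g) : Prop :=
  [/\ linear J, J (vframe 0) = vframe 0, J (vframe 1) = vframe 1,
      J (vframe 2) = vframe 2 & J (vframe 3) = - vframe 3].

Let oE (i : 'I_4) : [\/ i = 0, i = 1, i = 2 | i = 3].
Proof.
case: i => [[|[|[|[|//]]]] h];
  [constructor 1|constructor 2|constructor 3|constructor 4]; exact: val_inj.
Qed.

Lemma S01_formE x y :
  S01_form x y = x 0 0 * y 0 0 + x 0 1 * y 0 1 + x 0 2 * y 0 3 + x 0 3 * y 0 2.
Proof.
rewrite /S01_form !mxE !big_ord_recl big_ord0 !mxE !big_ord_recl !big_ord0 !mxE /=.
have E1 : lift ord0 ord0 = 1 :> 'I_4 by exact: val_inj.
have E2 : lift ord0 (lift ord0 ord0) = 2 :> 'I_4 by exact: val_inj.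
have E3 : lift ord0 (lift ord0 (lift ord0 ord0)) = 3 :> 'I_4 by exact: val_inj.
rewrite E1 E2 E3 (_ : ord0 = 0) //; ring.
Qed.

Lemma vframe_orthonormal i j :
  S01_form (vframe i) (vframe j) = (if i == 3 then -1 else 1) *+ (i == j).
Proof.
have s2 : (Num.sqrt 2 : R)^-1 * (Num.sqrt 2)^-1 = 2^-1.
  by rewrite -invfM -expr2 sqr_sqrtr ?ler0n.
have h2 : 2^-1 + 2^-1 = 1 :> R by field.
by case: (oE i) => ->; case: (oE j) => ->;
  rewrite S01_formE /vframe /= !mxE /= ?(mulr0, mul0r, mulr1, mul1r, addr0,
    add0r, sub0r, oppr0, subr0, mulrN, mulNr, opprK) ?mulr0n ?mulr1n ?s2 ?h2
    -?opprD ?h2 ?subrr ?addNr.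
Qed.

Lemma h3R_lie_bracket : lie_bracket h3R_bracket.
Proof.
split; first split.
- by move=> u a x y; apply/rowP => i; rewrite !mxE; ring.
- by move=> u a x y; apply/rowP => i; rewrite !mxE; ring.
- by move=> u; apply/rowP => i; rewrite !mxE; ring.
- by move=> u v w; apply/rowP => i; rewrite !mxE /=; ring.
Qed.

Lemma levi_civita_exists : exists nabla, levi_civita h3R_bracket S01_form nabla.
Proof.
exists (fun u v : g => 2^-1 *: ((u 0 0 * v 0 1 - u 0 1 * v 0 0) *: ebasis 2
  + v 0 3 *: (u 0 1 *: ebasis 0 - u 0 0 *: ebasis 1)
  + u 0 3 *: (v 0 1 *: ebasis 0 - v 0 0 *: ebasis 1))).
split; first split.
- by move=> u a x y; apply/rowP => i; rewrite !mxE; ring.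
- by move=> u a x y; apply/rowP => i; rewrite !mxE; ring.
- by move=> u v w; rewrite !S01_formE !mxE /=; field.
Qed.

Lemma product_structure_exists : exists J, product_structure J.
Proof.
exists (fun u : g => u 0 0 *: ebasis 0 + u 0 1 *: ebasis 1 + u 0 3 *: ebasis 2 + u 0 2 *: ebasis 3).
split; first by move=> a x y; apply/rowP => i; rewrite !mxE; ring.
all: by apply/rowP => i; case: (oE i) => ->; rewrite /vframe /= !mxE /=; ring.
Qed.

End Heisenberg.

(* Main.v *)
(** The Koszul formula pins down nabla, and in the null basis J fixes e_1, e_2
    and swaps e_3, e_4.  Hence Ric^0 has the closed form
    Ric^0(u) = (u_4 / 4) (e_3 + e_4): it takes central values and vanishes on the
    derived algebra spanned by e_3, so it is trivially a derivation. *)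
Require Import Defs.
From mathcomp Require Import all_boot all_order all_algebra.
From mathcomp Require Import ring.
From mathcomp Require Import reals.

Import Order.TTheory GRing.Theory Num.Theory.
Local Open Scope ring_scope.

(** Explicit coordinates in the basis e_1, ..., e_4. With every vector in this form, [congr row4]
    splits a vector identity into four scalar ones for [ring] or [field]. *)
Definition row4 {R : nzRingType} (a b c d : R) : 'rV[R]_4 :=
  \row_j nth 0 [:: a; b; c; d] j.

Lemma row4_eta {R : nzRingType} (x : 'rV[R]_4) :
  x = row4 (x 0 0) (x 0 1) (x 0 2) (x 0 3).
Proof.
by apply/rowP; case=> [[|[|[|[|//]]]] h]; rewrite mxE; congr (x _ _); apply: val_inj.
Qed.

Lemma row4D {R : nzRingType} (a b c d a' b' c' d' : R) :
  row4 a b c d + row4 a' b' c' d' = row4 (a + a') (b + b') (c + c') (d + d').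
Proof. by rewrite [LHS]row4_eta !mxE. Qed.

Lemma row4N {R : nzRingType} (a b c d : R) :
  - row4 a b c d = row4 (- a) (- b) (- c) (- d).
Proof. by rewrite [LHS]row4_eta !mxE. Qed.

Lemma row4Z {R : nzRingType} (k a b c d : R) :
  k *: row4 a b c d = row4 (k * a) (k * b) (k * c) (k * d).
Proof. by rewrite [LHS]row4_eta !mxE. Qed.

Definition row4_lin := (@row4N, @row4Z, @row4D).

Lemma sum_ord4 {V : nmodType} (F : 'I_4 -> V) :
  \sum_(k < 4) F k = F 0 + F 1 + F 2 + F 3.
Proof.
rewrite !big_ord_recl big_ord0 addr0 !addrA.
by congr (F _ + F _ + F _ + F _); apply: val_inj.
Qed.

Section Coordinates.
Variable R : realType.
Implicit Types a b c d : R.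

Lemma S01_form_row4 a b c d a' b' c' d' :
  S01_form (row4 a b c d) (row4 a' b' c' d') = a * a' + b * b' + c * d' + d * c'.
Proof. by rewrite S01_formE !mxE. Qed.

Lemma h3R_bracket_row4 a b c d a' b' c' d' :
  h3R_bracket (row4 a b c d) (row4 a' b' c' d') = row4 0 0 (a * b' - b * a') 0.
Proof. by rewrite [LHS]row4_eta !mxE /= !(mulr0, mulr1). Qed.

Lemma vframe_row4 (t := (Num.sqrt 2 : R)^-1) :
  [/\ vframe R 0 = row4 1 0 0 0, vframe R 1 = row4 0 1 0 0,
      vframe R 2 = row4 0 0 t t & vframe R 3 = row4 0 0 t (- t)].
Proof.
by split; rewrite [LHS]row4_eta /vframe !mxE /= ?addr0 ?subr0 ?add0r ?sub0r ?mulr0 ?mulr1 ?mulrN1.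
Qed.

(** Turns the Koszul formula, which only gives the pairings of nabla, into an explicit value of
    nabla. *)
Lemma S01_form_nondegenerate (x y : 'rV[R]_4) :
  (forall w, S01_form x w = S01_form y w) -> x = y.
Proof.
rewrite (row4_eta x) (row4_eta y) => E.
(* The form pairs e_3 with e_4, so e_4 reads off the third coordinate and e_3 the fourth. *)
have := (E (row4 1 0 0 0), E (row4 0 1 0 0), E (row4 0 0 0 1), E (row4 0 0 1 0)).
by rewrite !S01_form_row4 !(mulr0, mulr1, addr0, add0r) => -[[[-> ->] ->] ->].
Qed.

Section Connection.
Variables (nabla : 'rV[R]_4 -> 'rV[R]_4 -> 'rV[R]_4) (J : 'rV[R]_4 -> 'rV[R]_4).
Hypotheses (nablaLC : levi_civita (@h3R_bracket R) (@S01_form R) nabla)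
  (Jprod : product_structure J).

Lemma levi_civita_row4 a b c d a' b' c' d' :
  nabla (row4 a b c d) (row4 a' b' c' d') =
  row4 ((d' * b + d * b') / 2) (- (d' * a + d * a') / 2) ((a * b' - b * a') / 2) 0.
Proof.
apply: S01_form_nondegenerate => w.
have two_neq0 : (2 : R) != 0 by rewrite pnatr_eq0.
apply: (mulfI two_neq0); case: nablaLC => _ ->.
by rewrite [w]row4_eta !h3R_bracket_row4 !S01_form_row4; field.
Qed.

(** The vectors e_3 and e_4 are (v_3 + v_4) and (v_3 - v_4) over the square root of 2, and J flips
    v_4, hence swaps them. *)
Lemma product_structure_row4 a b c d : J (row4 a b c d) = row4 a b d c.
Proof.
case: Jprod => Jlin J0 J1 J2 J3; case: vframe_row4 => V0 V1 V2 V3.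
have s_neq0 : Num.sqrt 2 != 0 :> R by rewrite sqrtr_eq0 -ltNge ltr0n.
have JZ0 : J 0 = 0 by have := Jlin (-1) 0 0; rewrite scaler0 addr0 scaleN1r addNr.
(* Expansion in the frame. The right-nested shape ending in 0 lets each rewrite with [Jlin] peel off
   one frame vector. *)
have -> : row4 a b c d = a *: vframe R 0 + (b *: vframe R 1
    + (((c + d) * Num.sqrt 2 / 2) *: vframe R 2
    + (((c - d) * Num.sqrt 2 / 2) *: vframe R 3 + 0))).
  by rewrite addr0 V0 V1 V2 V3 !row4_lin; congr row4; field.
rewrite !Jlin JZ0 J0 J1 J2 J3 addr0 V0 V1 V2 V3 !row4_lin.
by congr row4; field.
Qed.

(** As J is an involution, nabla^0_u v is the average of nabla_u v and J nabla_u (J v). This makes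
    the last two coordinates equal and leaves only c' + d' from those of v; in particular v_4 is
    parallel. *)
Lemma canonical_connection_row4 a b c d a' b' c' d' :
  canonical_connection nabla J (row4 a b c d) (row4 a' b' c' d') =
  row4 (((c' + d') * b + 2 * d * b') / 4) (- ((c' + d') * a + 2 * d * a') / 4)
       ((a * b' - b * a') / 4) ((a * b' - b * a') / 4).
Proof.
rewrite /canonical_connection /nablaJ !product_structure_row4.
rewrite !levi_civita_row4 product_structure_row4 !row4_lin.
by congr row4; field.
Qed.

Lemma canonical_curvature_row4 a b c d a' b' c' d' a'' b'' c'' d'' :
  curvature (@h3R_bracket R) (canonical_connection nabla J)
    (row4 a b c d) (row4 a' b' c' d') (row4 a'' b'' c'' d'') =
  row4 ((b'' * (a * b' - b * a') + (c'' + d'') * (d * a' - d' * a)) / 8)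
       (((c'' + d'') * (d * b' - d' * b) - a'' * (a * b' - b * a')) / 8)
       ((d' * (a * a'' + b * b'') - d * (a' * a'' + b' * b'')) / 8)
       ((d' * (a * a'' + b * b'') - d * (a' * a'' + b' * b'')) / 8).
Proof.
rewrite /curvature h3R_bracket_row4 !canonical_connection_row4 !row4_lin.
by congr row4; field.
Qed.

Lemma ricci_canonical_row4 a b c d :
  ricci (@h3R_bracket R) (@S01_form R) (@vframe R) (canonical_connection nabla J)
    (row4 a b c d) = row4 0 0 (d / 4) (d / 4).
Proof.
rewrite /ricci sum_ord4 !vframe_orthonormal.
case: vframe_row4 => -> -> -> ->.
rewrite !canonical_curvature_row4 !eqxx !mulr1n /= !row4_lin.
have s2 : (Num.sqrt 2 : R) ^+ 2 = 2 by rewrite sqr_sqrtr ?ler0n.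
have s_neq0 : Num.sqrt 2 != 0 :> R by rewrite sqrtr_eq0 -ltNge ltr0n.
(* The v_4 term vanishes because v_4 is parallel. Those of v_1 and v_2 each give d/8 in the last two
   coordinates, plus -b/8 along e_2 and -a/8 along e_1 respectively; [s2] is what makes the v_3 term
   exactly cancel these. *)
by congr row4; field: s2.
Qed.

End Connection.
End Coordinates.

Theorem theorem4p6 (R : realType)
    (nabla : 'rV[R]_4 -> 'rV[R]_4 -> 'rV[R]_4) (J : 'rV[R]_4 -> 'rV[R]_4)
    (nablaLC : levi_civita (@h3R_bracket R) (@S01_form R) nabla)
    (Jprod : product_structure J) :
  let nabla0 := canonical_connection nabla J in
  let Ric0 := ricci (@h3R_bracket R) (@S01_form R) (@vframe R) nabla0 in
  first_kind_soliton_with (@h3R_bracket R) (@S01_form R) (@vframe R) nabla0 0 Ric0.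
Proof.
move=> nabla0 Ric0.
have Ric0E a b c d : Ric0 (row4 a b c d) = row4 0 0 (d / 4) (d / 4).
  exact: ricci_canonical_row4.
split; last by move=> u; rewrite scale0r add0r.
split=> [k x y|x y]; rewrite (row4_eta x) (row4_eta y).
  by rewrite !row4_lin !Ric0E !row4_lin; congr row4; ring.
(* Both sides are 0: values of [Ric0] have no e_1, e_2 part, and brackets have no e_4 part. *)
by rewrite h3R_bracket_row4 !Ric0E !h3R_bracket_row4 row4D; congr row4; ring.
Qed.
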